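(* Let $d$ and $n$ be positive integers. Let $\mu$ be a Borel probability measure on $\mathbb{R}^d$ which has a density $\rho$ with respect to Lebesgue measure and satisfies $\int_{\mathbb{R}^d}\|x\|\,\mu(\mathrm{d}x)<\infty$. Let $S=\{s^1,\dots,s^n\}\subset\mathbb{R}^d$ be a set of $n$ distinct points, and let $\nu=\sum_{i=1}^n\lambda_i\delta_{s^i}$ be a probability measure with all $\lambda_i>0$. Define $\Phi:\mathbb{R}^n\to\mathbb{R}$ by $$\Phi(w)=\sum_{i=1}^n\left(-\lambda_i w_i-\int_{\mathrm{Vor}_S^w(i)}\left(\|x-s^i\|-w_i\right)\mu(\mathrm{d}x)\right).$$ Then: a) $\Phi$ is convex. b) $\Phi$ is differentiable, with partial derivatives $$\frac{\partial\Phi}{\partial w_i}(w)=-\lambda_i+\mu(\mathrm{Vor}_S^w(i)),\qquad i=1,\dots,n.$$ Note that $\Phi$ can be written as $$\Phi(w)=\sum_{i=1}^n(-\lambda_i w_i)-\int_{\mathbb{R}^d}\left(\|x-T_S^w(x)\|-w_{T_S^w(x)}\right)\mu(\mathrm{d}x),$$ where $w_{s^i}:=w_i$.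
   Context: $\|\cdot\|$ is the Euclidean norm on $\mathbb{R}^d$, and $\delta_p$ is the Dirac probability measure at $p$. For a weight vector $w\in\mathbb{R}^n$, the (additively weighted) Voronoi cell of $s^i$ is $$\mathrm{Vor}_S^w(i)=\{x\in\mathbb{R}^d : \|x-s^i\|-w_i\le\|x-s^j\|-w_j\ \text{for all } j\ne i\}.$$ The map $T_S^w$ sends each point $x\in\mathbb{R}^d$ to the site $s^i$ of the Voronoi cell containing $x$. It is regarded as a $\mu$-almost everywhere well-defined map, the boundaries of the Voronoi cells (on which it is not well-defined) being asserted to be null sets.
   Formalization: For d = 1 the formal theorem additionally assumes that, for every w, distinct Voronoi cells overlap in a μ-null set; without this the claim fails (e.g. sites 0 and 1, μ uniform on [2,3], w = (1,0)). For d ≥ 2 nothing is added. *)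

(* Defs.v *)
From HB Require Import structures.
From mathcomp Require Import all_boot all_order all_algebra.
From mathcomp Require Import all_classical all_reals all_analysis.

Set Implicit Arguments.
Unset Strict Implicit.
Unset Printing Implicit Defensive.
Import Order.TTheory GRing.Theory Num.Theory.
Import numFieldNormedType.Exports.
Local Open Scope classical_set_scope.
Local Open Scope ring_scope.

(* The library's sigma-algebra on tuples is generated by the coordinate maps;
   on [Rd R d] it is the Borel sigma-algebra of R^d. *)
Notation Rd R d := (d.-tuple (measurableTypeR R)).

Section lebesgue_Rd.
Context {R : realType}.

Definition cons_Rd d (p : measurableTypeR R * Rd R d) : Rd R d.+1 :=
  [tuple of p.1 :: p.2].

Lemma measurable_cons_Rd d : measurable_fun setT (@cons_Rd d).
Proof. exact: measurable_cons. Qed.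

Section step.
Local Open Scope ereal_scope.
Variables (d : nat) (m : {sigma_finite_measure set (Rd R d) -> \bar R}).

Definition lebesgue_step : set (Rd R d.+1) -> \bar R :=
  pushforward (lebesgue_measure \x m) (@cons_Rd d).

Let cons_preimage A : measurable A -> measurable (@cons_Rd d @^-1` A).
Proof.
by move=> mA; rewrite -[X in measurable X]setTI; exact: measurable_cons_Rd.
Qed.

Let step0 : lebesgue_step set0 = 0.
Proof. by rewrite /lebesgue_step /pushforward preimage_set0 measure0. Qed.

Let step_ge0 A : 0 <= lebesgue_step A.
Proof. by rewrite /lebesgue_step /pushforward measure_ge0. Qed.

Let step_sigma_additive : semi_sigma_additive lebesgue_step.
Proof.
move=> F mF tF mUF; rewrite /lebesgue_step /pushforward preimage_bigcup.
apply: measure_semi_sigma_additive.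
- by move=> k; exact: cons_preimage.
- apply/trivIsetP => /= i j _ _ ij; rewrite -preimage_setI.
  by move/trivIsetP : tF => /(_ _ _ _ _ ij) ->//; rewrite preimage_set0.
- by rewrite -preimage_bigcup; exact: cons_preimage.
Qed.

HB.instance Definition _ := isMeasure.Build _ _ _ lebesgue_step
  step0 step_ge0 step_sigma_additive.

Let step_sigma_finite : sigma_finite setT lebesgue_step.
Proof.
have /sigma_finiteP[F [FT ndF Foo]] := sigma_finiteT (@lebesgue_measure R).
have /sigma_finiteP[G [GT ndG Goo]] := sigma_finiteT m.
pose g (t : Rd R d.+1) : measurableTypeR R * Rd R d :=
  (tnth t ord0, [tuple of behead t]).
have gK t : cons_Rd (g t) = t by apply/val_inj; case/tupleP: t => a t.
have Kg p : g (cons_Rd p) = p.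
  by case: p => a t; rewrite /g /cons_Rd/=; congr pair; exact/val_inj.
have mg : measurable_fun setT g.
  apply: measurable_fun_pair; first exact: measurable_tnth.
  exact: measurable_behead.
exists (fun k => g @^-1` (F k `*` G k)).
  rewrite -preimage_bigcup -(preimage_setT g); congr (_ @^-1` _).
  rewrite -setXTT FT GT; apply/seteqP; split => [[x y]|[x y]] /=.
    move=> [/= [i _ Fix] [j _ Gjy]]; exists (maxn i j) => //; split => /=.
    - by move: x Fix; exact/subsetPset/ndF/leq_maxl.
    - by move: y Gjy; exact/subsetPset/ndG/leq_maxr.
  by move=> [i _ []/= ? ?]; split; exists i.
move=> k; have [mF Fk] := Foo k; have [mG Gk] := Goo k; split.
  by rewrite -[X in measurable X]setTI; apply: mg => //; exact: measurableX.
rewrite /lebesgue_step /pushforward (_ : _ @^-1` _ = F k `*` G k).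
  by rewrite product_measure1E// lte_mul_pinfty// ge0_fin_numE.
by apply/funext => p; rewrite /preimage /mkset Kg.
Qed.

HB.instance Definition _ := Measure_isSigmaFinite.Build _ _ _ lebesgue_step
  step_sigma_finite.

End step.

Fixpoint lebesgue_Rd (d : nat) : {sigma_finite_measure set (Rd R d) -> \bar R} :=
  match d with
  | 0 => @dirac _ (Rd R 0) [tuple] R
  | d'.+1 => lebesgue_step (lebesgue_Rd d')
  end.

Lemma lebesgue_Rd_box d (A : 'I_d -> set (measurableTypeR R)) :
  (forall i, measurable (A i)) ->
  lebesgue_Rd d [set x | forall i, A i (tnth x i)] =
  (\prod_(i < d) lebesgue_measure (A i))%E.
Proof.
elim: d A => [|d IH] A mA /=.
  rewrite big_ord0 diracE (_ : _ \in _ = true)//.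
  by apply/mem_set => -[].
rewrite /lebesgue_step /pushforward big_ord_recl -IH//.
rewrite -product_measure1E//; last first.
  rewrite (_ : [set x | _] =
    \bigcap_(i in [set: 'I_d]) ((@tnth d (measurableTypeR R))^~ i @^-1` A (lift ord0 i))).
    apply: fin_bigcap_measurable => // i _.
    by rewrite -[X in measurable X]setTI; exact: measurable_tnth.
  by apply/seteqP; split => [x xA i _|x xA i]; [exact: xA|exact: (xA i)].
congr (_ _); apply/seteqP; split => -[a t] /=.
  move=> H; split => /=; first by have := H ord0; rewrite tnth0.
  by move=> i; have := H (lift ord0 i); rewrite tnthS.
move=> [aA tA] i; case: (unliftP ord0 i) => [j|] ->; last by rewrite tnth0.
by rewrite tnthS; exact: tA.
Qed.

End lebesgue_Rd.

Section semidiscrete.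
Context {R : realType} {d n : nat}.
Implicit Types (x p : Rd R d) (s : 'I_n -> Rd R d) (w : 'rV[R]_n).

Definition eucl_dist x p : R :=
  Num.sqrt (\sum_(k < d) (tnth x k - tnth p k) ^+ 2).

Definition eucl_norm x : R := Num.sqrt (\sum_(k < d) tnth x k ^+ 2).

Definition Vor s w (i : 'I_n) : set (Rd R d) :=
  [set x | forall j, j != i ->
    eucl_dist x (s i) - w 0 i <= eucl_dist x (s j) - w 0 j].

Definition Phi (mu : {measure set (Rd R d) -> \bar R}) (lambda : 'I_n -> R) s w
    : R :=
  \sum_(i < n) (- (lambda i * w 0 i)
    - \int[mu]_(x in Vor s w i) (eucl_dist x (s i) - w 0 i)).

(* [w_{s^i} := w_i]; the sum has a single term when [s] is injective. *)
Definition site_weight s w p : R := \sum_(i < n | s i == p) w 0 i.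

(* Only almost everywhere, since a point may lie in several cells. *)
Definition is_site_map (mu : {measure set (Rd R d) -> \bar R}) s w
    (T : Rd R d -> Rd R d) :=
  {ae mu, forall x, exists2 i, Vor s w i x & T x = s i}.

End semidiscrete.

(* Main.v *)
Require Import Defs.
From HB Require Import structures.
From mathcomp Require Import all_boot all_order all_algebra ring lra.
From mathcomp Require Import all_classical all_reals all_analysis.
From mathcomp Require Import measurable_realfun.
Import Order.TTheory GRing.Theory Num.Theory.
Import numFieldNormedType.Exports.
Local Open Scope classical_set_scope.
Local Open Scope ring_scope.

(* Cells overlap in a null set: in dimension at least 2 the locus
   |x - a| - |x - b| = c lies on a quadric that does not vanish identically.
   Zero sets of such functions are null by induction on the dimension: a
   function that is polynomial along lines and nonzero at (t0, x0) is nonzero at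
   (t, x0) for all but finitely many t, and for those t its slice is null by
   induction.

   Hence Phi(w) = - sum_i lambda_i w_i - int g_w dmu, where the lower envelope
   g_w(x) = min_i (|x - s_i| - w_i) is a minimum of affine functions of w.
   Concavity of w |-> g_w(x) gives convexity of Phi.  The linearization of
   g_(w+h)(x) at h = 0 is exact unless x is within 2|h| of a tie between two
   cells, and its error is at most (1 + n)|h|; the set of such x shrinks to the
   null set of ties as h tends to 0, so the integrated error is o(|h|). *)

Set Implicit Arguments.
Unset Strict Implicit.
Unset Printing Implicit Defensive.

(** * Null zero sets of functions that are polynomial along lines *)

Section zero_sets.
Context {R : realType}.

Lemma finite_set_root (P : {poly R}) : P != 0 -> finite_set [set t | root P t].
Proof.
have [n] := ubnP (size P); elim: n P => // n IH P sP P0.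
have [[a Pa]|noroot] := pselect (exists a, root P a); last first.
  rewrite (_ : [set _ | _] = set0) //.
  by rewrite -subset0 => t /= Pt; apply: noroot; exists t.
have /factor_theorem [Q PE] := Pa.
have Q0 : Q != 0 by apply: contra_neq P0 => Q0; rewrite PE Q0 mul0r.
apply: (@sub_finite_set _ _ ([set t | root Q t] `|` [set a])).
  move=> t /=; rewrite PE rootM root_XsubC => /orP[]; first by left.
  by move=> /eqP; right.
rewrite finite_setU; split => //; apply: IH => //.
move: sP; rewrite PE size_Mmonic ?monicXsubC// size_XsubC addn2 /=.
by rewrite ltnS; exact: leq_ltn_trans.
Qed.

Definition line d (p v : Rd R d) (t : R) : Rd R d :=
  [tuple tnth p i + t * tnth v i | i < d].

(** This weak form of polynomiality, with no bound on the degree, suffices for slicing. It passes to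
    slices, since a line in a slice is a line of the whole space ([line_cons0]). *)
Definition polynomial_on_lines d (f : Rd R d -> R) :=
  forall p v, exists P : {poly R}, forall t, f (line p v t) = P.[t].

Lemma line_cons0 d (a : R) (p v : Rd R d) t :
  line (cons_Rd (a, p)) (cons_Rd (0, v)) t = cons_Rd (a, line p v t).
Proof.
apply: eq_from_tnth => i; rewrite tnth_mktuple /cons_Rd/=.
case: (unliftP ord0 i) => [j|] ->; first by rewrite !tnthS tnth_mktuple.
by rewrite !tnth0 mulr0 addr0.
Qed.

Lemma line_cons1 d (p : Rd R d) t :
  line (cons_Rd (0, p)) (cons_Rd (1, [tuple 0 | i < d])) t = cons_Rd (t, p).
Proof.
apply: eq_from_tnth => i; rewrite tnth_mktuple /cons_Rd/=.
case: (unliftP ord0 i) => [j|] ->; last by rewrite !tnth0 add0r mulr1.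
by rewrite !tnthS tnth_mktuple mulr0 addr0.
Qed.

Lemma lebesgue_Rd_polynomial_zeros d (f : Rd R d -> R) :
  measurable_fun setT f -> polynomial_on_lines f -> (exists p, f p != 0) ->
  lebesgue_Rd d [set x | f x = 0] = 0%E.
Proof.
have mzeros d' (g : Rd R d' -> R) : measurable_fun setT g ->
    measurable [set x | g x = 0].
  move=> mg; rewrite [X in measurable X](_ : _ = setT `&` g @^-1` [set 0]).
    exact: mg.
  by rewrite setTI.
elim: d f => [|d IH] f mf Pf [p fp].
  (* Dimension 0: the space is a single point, at which [f] is nonzero. *)
  rewrite /= diracE memNset//= => fp0.
  by move: fp; rewrite (tuple0 p) fp0 eqxx.
have mcons t : measurable_fun setT (fun x : Rd R d => cons_Rd (t, x)).
  by apply: measurableT_comp; [exact: measurable_cons_Rd|exact: measurable_pair1].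
have [a [q pE]] : exists a q, p = @cons_Rd R d (a, q).
  by case/tupleP: p {fp} => a q; exists a, q; apply/val_inj.
(* [P] is [f] along the line through [p] in the first coordinate direction; its value at [a] is
   [f p], hence [P != 0]. *)
have [P PE] := Pf (cons_Rd (0, q)) (cons_Rd (1, [tuple 0 | i < d])).
have P0 : P != 0.
  by apply: contra_neq fp => P0; rewrite pE -line_cons1 PE P0 horner0.
rewrite /= /lebesgue_step /pushforward /product_measure1.
set Z := _ @^-1` _.
have mZ : measurable Z.
  rewrite -[Z]setTI; apply: measurable_cons_Rd => //; exact: mzeros.
(* The measure of [Z] is the integral over [t] of the measures of its slices, so null slices for
   almost every [t] suffice. The exceptional [t] are the roots of [P]. *)
rewrite (@ae_eq_integral _ _ _ _ _ (cst 0%E)) ?integral_cst ?mul0e//.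
  exact: measurable_fun_xsection.
have finP := finite_set_root P0.
exists [set t | root P t]; split.
- exact/countable_measurable/finite_set_countable.
- exact/countable_lebesgue_measure0/finite_set_countable.
move=> t /= /not_implyP[_] nz; apply: contra_notT nz => Pt.
rewrite (_ : xsection Z t = [set x | f (cons_Rd (t, x)) = 0]); last first.
  by apply/seteqP; split => x; rewrite /xsection/= inE.
apply: IH.
- exact: measurableT_comp.
- move=> u v; have [Q QE] := Pf (cons_Rd (t, u)) (cons_Rd (0, v)).
  by exists Q => r; rewrite -line_cons0 QE.
- by exists q; rewrite -line_cons1 PE.
Qed.

Lemma polynomial_on_linesM d (f g : Rd R d -> R) :
  polynomial_on_lines f -> polynomial_on_lines g ->
  polynomial_on_lines (fun x => f x * g x).
Proof.
move=> Pf Pg p v; have [P PE] := Pf p v; have [Q QE] := Pg p v.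
by exists (P * Q) => t; rewrite hornerM PE QE.
Qed.

Lemma polynomial_on_linesB d (f g : Rd R d -> R) :
  polynomial_on_lines f -> polynomial_on_lines g ->
  polynomial_on_lines (fun x => f x - g x).
Proof.
move=> Pf Pg p v; have [P PE] := Pf p v; have [Q QE] := Pg p v.
by exists (P - Q) => t; rewrite hornerD hornerN PE QE.
Qed.

Lemma polynomial_on_lines_cst d (c : R) :
  polynomial_on_lines (fun _ : Rd R d => c).
Proof. by move=> p v; exists c%:P => t; rewrite hornerC. Qed.

(** * Loci where the difference of the distances to two points is constant *)

Definition sq_dist d (x p : Rd R d) : R :=
  \sum_(k < d) (tnth x k - tnth p k) ^+ 2.

Lemma polynomial_on_lines_sq_dist d (q : Rd R d) :
  polynomial_on_lines (fun x => sq_dist x q).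
Proof.
move=> p v.
exists (\sum_(k < d) ((tnth p k - tnth q k)%:P + (tnth v k)%:P * 'X) ^+ 2) => t.
rewrite horner_sum; apply: eq_bigr => k _.
by rewrite tnth_mktuple !hornerE; ring.
Qed.

Lemma measurable_sq_dist d (p : Rd R d) :
  measurable_fun setT (fun x => sq_dist x p).
Proof.
apply: measurable_sum => k; apply: measurable_funX.
by apply: measurable_funB => //; exact: measurable_tnth.
Qed.

Lemma sq_dist_ge0 d (x p : Rd R d) : 0 <= sq_dist x p.
Proof. by apply: sumr_ge0 => k _; exact: sqr_ge0. Qed.

Lemma sqr_eucl_dist d (x p : Rd R d) : eucl_dist x p ^+ 2 = sq_dist x p.
Proof. by rewrite /eucl_dist sqr_sqrtr// sq_dist_ge0. Qed.

Lemma sq_dist_eq0 d (x p : Rd R d) : (sq_dist x p == 0) = (x == p).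
Proof.
apply/eqP/eqP => [|->]; last first.
  by apply: big1 => k _; rewrite subrr expr0n.
move=> /psumr_eq0P xp; apply: eq_from_tnth => k; apply/eqP.
by rewrite -subr_eq0 -sqrf_eq0 xp// => j _; exact: sqr_ge0.
Qed.

(* Eliminating the square roots from |x - a| - |x - b| = c. *)
Definition focal_quadric d (a b : Rd R d) (c : R) (x : Rd R d) : R :=
  (sq_dist x a - sq_dist x b - c ^+ 2) * (sq_dist x a - sq_dist x b - c ^+ 2)
  - 4 * c ^+ 2 * sq_dist x b.

Lemma focal_quadric_eq0 d (a b : Rd R d) (c : R) (x : Rd R d) :
  eucl_dist x a - eucl_dist x b = c -> focal_quadric a b c x = 0.
Proof. by rewrite /focal_quadric -!sqr_eucl_dist => <-; ring. Qed.

Lemma measurable_focal_quadric d (a b : Rd R d) (c : R) :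
  measurable_fun setT (focal_quadric a b c).
Proof.
have mL : measurable_fun setT (fun x => sq_dist x a - sq_dist x b - c ^+ 2).
  apply: measurable_funB => //.
  by apply: measurable_funB; exact: measurable_sq_dist.
apply: measurable_funB; first exact: measurable_funM.
by apply: measurable_funM => //; exact: measurable_sq_dist.
Qed.

Lemma polynomial_on_lines_focal_quadric d (a b : Rd R d) (c : R) :
  polynomial_on_lines (focal_quadric a b c).
Proof.
have PL : polynomial_on_lines (fun x => sq_dist x a - sq_dist x b - c ^+ 2).
  apply: polynomial_on_linesB; last exact: polynomial_on_lines_cst.
  by apply: polynomial_on_linesB; exact: polynomial_on_lines_sq_dist.
apply: polynomial_on_linesB; first exact: polynomial_on_linesM.
apply: polynomial_on_linesM; first exact: polynomial_on_lines_cst.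
exact: polynomial_on_lines_sq_dist.
Qed.

(* At [x = b] the quadric takes the value [(|a - b|^2 - c^2)^2]; when this
   vanishes, [x = b + v] with [v] orthogonal to [a - b] gives [-4 c^2 |v|^2]. *)
Lemma focal_quadric_neq0 d (a b : Rd R d) (c : R) : (1 < d)%N -> a != b ->
  exists x, focal_quadric a b c x != 0.
Proof.
move=> d1 ab.
have bb : sq_dist b b = 0 by apply/eqP; rewrite sq_dist_eq0.
have ba0 : sq_dist b a != 0 by rewrite sq_dist_eq0 eq_sym.
have [qb|qb] := eqVneq (sq_dist b a) (c ^+ 2); last first.
  exists b; rewrite /focal_quadric bb subr0 mulr0 subr0 -expr2 sqrf_eq0.
  by rewrite subr_eq0.
have [k abk] : exists k, tnth b k - tnth a k != 0.
  apply: contrapT => /forallNP abk; move/eqP: ab; apply.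
  apply: eq_from_tnth => k; apply/eqP.
  by move/negP: (abk k); rewrite negbK subr_eq0 eq_sym.
have [l lk] : exists l : 'I_d, l != k.
  have [k0|k0] := eqVneq (k : nat) 0%N.
    by exists (Ordinal d1); apply/eqP => /(congr1 val)/=; rewrite k0.
  by exists (Ordinal (ltnW d1)); rewrite -val_eqE/= eq_sym.
(* A quarter turn of the [(k, l)] coordinates of [b - a]; the entry at [l] is nonzero by the choice
   of [k]. *)
pose v (i : 'I_d) := if i == k then - (tnth b l - tnth a l)
  else if i == l then tnth b k - tnth a k else 0.
pose x : Rd R d := [tuple tnth b i + v i | i < d].
have vE : sq_dist x b = \sum_i v i ^+ 2.
  by apply: eq_bigr => i _; rewrite tnth_mktuple addrAC subrr add0r.
have orth : \sum_i v i * (tnth b i - tnth a i) = 0.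
  rewrite (bigD1 k)//= (bigD1 l)//= big1 => [|i /andP[ik il]].
    by rewrite /v eqxx (negbTE lk) eqxx; ring.
  by rewrite /v (negbTE ik) (negbTE il) mul0r.
have xaE : sq_dist x a = sq_dist b a + sq_dist x b.
  have -> : sq_dist b a = sq_dist b a + 2 * (\sum_i v i * (tnth b i - tnth a i)).
    by rewrite orth mulr0 addr0.
  rewrite vE mulr_sumr -!big_split/=; apply: eq_bigr => i _.
  by rewrite tnth_mktuple; ring.
exists x; rewrite /focal_quadric xaE qb.
rewrite addrK subrr mul0r sub0r oppr_eq0 -qb !mulf_neq0//.
rewrite vE; apply/eqP => /psumr_eq0P v0.
have /eqP := v0 (fun i _ => sqr_ge0 _) l isT.
by rewrite sqrf_eq0 /v (negbTE lk) eqxx (negbTE abk).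
Qed.

(** Squaring can add points, so the locus is only enclosed in the zero set of the quadric; that is
    enough for it to be negligible. *)
Lemma lebesgue_Rd_equal_dist_difference d (a b : Rd R d) (c : R) :
  (1 < d)%N -> a != b ->
  exists N, [/\ measurable N, lebesgue_Rd d N = 0%E &
    [set x | eucl_dist x a - eucl_dist x b = c] `<=` N].
Proof.
move=> d1 ab; exists [set x | focal_quadric a b c x = 0]; split.
- rewrite [X in measurable X](_ : _ = setT `&` focal_quadric a b c @^-1` [set 0]).
    exact: measurable_focal_quadric.
  by rewrite setTI.
- apply: lebesgue_Rd_polynomial_zeros.
  + exact: measurable_focal_quadric.
  + exact: polynomial_on_lines_focal_quadric.
  + exact: focal_quadric_neq0.
- by move=> x; exact: focal_quadric_eq0.
Qed.

End zero_sets.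

(** * Integrals of almost everywhere equal functions and of finite sums *)

Section integrals.
Context {dT : measure_display} {T : measurableType dT} {R : realType}.
Variable mu : {measure set T -> \bar R}.

Section nonmeasurable.
Import HBNNSimple.
Local Open Scope ereal_scope.

Let ge0_le_integral_off_null (f g : T -> \bar R) (N : set T) :
  measurable N -> mu N = 0 -> (forall x, 0 <= f x) -> (forall x, 0 <= g x) ->
  (forall x, ~ N x -> f x = g x) -> \int[mu]_x f x <= \int[mu]_x g x.
Proof.
move=> mN N0 f0 g0 fg; rewrite ge0_integralTE// ge0_integralTE//.
apply: ge_ereal_sup => _ [h /= hf <-].
have mNC : measurable (~` N) by exact: measurableC.
apply: ereal_sup_ubound.
exists (mul_nnsfun h (indic_nnsfun R mNC)) => [x /=|].
  have [Nx|Nx] := pselect (N x).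
    by rewrite mindicE memNset//= mulr0.
  by rewrite mindicE mem_set// mulr1 -fg.
rewrite -!integralT_nnsfun; apply: ae_eq_integral => //.
- exact/measurable_EFinP/measurable_funP.
- exact/measurable_EFinP/measurable_funP.
exists N; split => // x /= /not_implyP[_] hx.
apply: contrapT => Nx; apply: hx.
by rewrite mindicE mem_set// mulr1.
Qed.

Let ge0_ae_eq (f g : T -> \bar R) :
  (forall x, 0 <= f x) -> (forall x, 0 <= g x) ->
  {ae mu, forall x, f x = g x} -> \int[mu]_x f x = \int[mu]_x g x.
Proof.
move=> f0 g0 [N [mN N0 fgN]].
have fg x : ~ N x -> f x = g x.
  by move=> Nx; apply: contrapT => fgx; apply: Nx; exact: fgN.
apply/eqP; rewrite eq_le; apply/andP; split.
  exact: (ge0_le_integral_off_null mN).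
by apply: (ge0_le_integral_off_null mN) => // x /fg.
Qed.

(* Unlike [ae_eq_integral], the functions need not be measurable: any simple
   minorant can be set to 0 on the exceptional null set. *)
Lemma integral_ae_eq_nonmeasurable (f g : T -> \bar R) :
  {ae mu, forall x, f x = g x} -> \int[mu]_x f x = \int[mu]_x g x.
Proof.
move=> fg; rewrite integralE [RHS]integralE; congr (_ - _).
  apply: ge0_ae_eq => //; apply: filterS fg => x fgx.
  by rewrite !funeposE fgx.
apply: ge0_ae_eq => //; apply: filterS fg => x fgx.
by rewrite !funenegE fgx.
Qed.

End nonmeasurable.

Lemma Rintegral_ae_eq_nonmeasurable (f g : T -> R) :
  {ae mu, forall x, f x = g x} -> \int[mu]_x f x = \int[mu]_x g x.
Proof.
move=> fg; congr fine; apply: integral_ae_eq_nonmeasurable.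
by apply: filterS fg => x ->.
Qed.

Lemma integrable_sumr (I : Type) (s : seq I) (f : I -> T -> R) :
  (forall i, mu.-integrable setT (EFin \o f i)) ->
  mu.-integrable setT (EFin \o (fun x => \sum_(i <- s) f i x)).
Proof.
move=> fi.
have := integrable_sum measurableT s (fun i (_ : predT i) => fi i).
apply: eq_integrable => //.
by move=> x _ /=; rewrite sumEFin.
Qed.

Lemma Rintegral_sum (I : Type) (s : seq I) (f : I -> T -> R) :
  (forall i, mu.-integrable setT (EFin \o f i)) ->
  \int[mu]_x (\sum_(i <- s) f i x) = \sum_(i <- s) \int[mu]_x f i x.
Proof.
move=> fi; elim: s => [|i s IH].
  under eq_Rintegral do rewrite big_nil.
  by rewrite Rintegral_cst// mul0r big_nil.
under eq_Rintegral do rewrite big_cons.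
by rewrite big_cons -IH RintegralD//; exact: integrable_sumr.
Qed.

End integrals.

(** * Linear forms as differentials *)

Section linear_forms.
Context {R : realType} {n : nat}.
Implicit Types (a : 'I_n -> R) (h w : 'rV[R]_n).

Definition linear_form a h : R := \sum_i a i * h 0 i.

Let linear_form_is_linear a : linear (linear_form a).
Proof.
move=> k u v; rewrite /linear_form scaler_sumr -big_split/=.
by apply: eq_bigr => i _; rewrite !mxE /GRing.scale/=; ring.
Qed.

HB.instance Definition _ a :=
  GRing.isLinear.Build R 'rV[R]_n R *:%R (linear_form a)
    (linear_form_is_linear a).

Lemma continuous_linear_form a : continuous (linear_form a).
Proof.
move=> w; apply: (@cvg_big _ _ _ _ _ _ _ (nbhs w)) => [|i _].
  exact: add_continuous.
apply: (@continuous_comp _ _ _ (fun h : 'rV[R]_n => h 0 i) ( *%R (a i))).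
  exact: coord_continuous.
exact: mulrl_continuous.
Qed.

(** The hypothesis is the little-o expansion with explicit [e]. Uniqueness of the differential then
    applies because the linear form is continuous. *)
Lemma differentiable_linear_form (f : 'rV[R]_n -> R) w a :
  (forall e : R, 0 < e ->
    \forall h \near (0 : 'rV[R]_n), `|f (h + w) - f w - linear_form a h| <= e * `|h|) ->
  differentiable f w /\ 'd f w = linear_form a :> ('rV[R]_n -> R).
Proof.
move=> small.
have fE : f \o shift w = cst (f w) + linear_form a +o_ (0 : 'rV[R]_n) id.
  apply/eqaddoP => e e0; near=> h => /=.
  rewrite !fctE/= opprD addrA.
  by near: h; exact: small.
have dE : 'd f w = linear_form a :> ('rV[R]_n -> R).
  by apply: diff_unique fE; exact: continuous_linear_form.
by split=> //; apply/diff_locallyP; rewrite dE; split => //;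
  exact: continuous_linear_form.
Unshelve. all: by end_near. Qed.

Lemma coord_le_norm h i : `|h 0 i| <= `|h|.
Proof.
rewrite [leRHS]/Num.norm/= mx_normrE.
exact: (le_bigmax _ (fun ij : 'I_1 * 'I_n => `|h ij.1 ij.2|) (0, i)).
Qed.

End linear_forms.

(** * The lower envelope of shifted costs: pointwise estimates *)

Section lower_envelope.
Context {dT : measure_display} {T : measurableType dT} {R : realType} {n : nat}.
Variables (mu : probability T R) (i0 : 'I_n) (c : 'I_n -> T -> R).
Implicit Types (w h : 'rV[R]_n) (x : T).

(** Costs are abstract here; when [c i x] is the distance from [x] to the site [s i], this is [Vor]
    by conversion. *)
Definition cell w i : set T :=
  [set x | forall j, j != i -> c i x - w 0 i <= c j x - w 0 j].

(* [i0] only serves as the default value of the minimum. *)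
Definition envelope w x : R :=
  \big[Order.min/c i0 x - w 0 i0]_i (c i x - w 0 i).

Lemma envelope_le w x i : envelope w x <= c i x - w 0 i.
Proof. exact: (bigmin_le _ _ (fun i => c i x - w 0 i)). Qed.

Lemma le_envelope w x (a : R) :
  (forall i, a <= c i x - w 0 i) -> a <= envelope w x.
Proof. by move=> ai; apply/bigmin_geP; split=> // i _. Qed.

Lemma envelope_attained w x : exists i, envelope w x = c i x - w 0 i.
Proof.
apply: contrapT => /forallNP ne.
(* Otherwise every term, including the default one at [i0], would lie strictly above the minimum,
   and so would their minimum. *)
suff : envelope w x < envelope w x by rewrite ltxx.
apply/bigmin_gtP; split=> [|i _];
  by rewrite lt_neqAle envelope_le andbT; apply/eqP/ne.
Qed.

Lemma cellP w i x : cell w i x <-> c i x - w 0 i = envelope w x.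
Proof.
split=> [Vx|iE j _]; last by rewrite iE envelope_le.
apply/eqP; rewrite eq_le envelope_le andbT; apply: le_envelope => j.
by have [->//|] := eqVneq j i; exact: Vx.
Qed.

Lemma envelope_concave w w' x (t : R) : 0 <= t <= 1 ->
  t * envelope w x + (1 - t) * envelope w' x <=
  envelope (t *: w + (1 - t) *: w') x.
Proof.
move=> /andP[t0 t1]; apply: le_envelope => i; rewrite !mxE.
have -> : c i x - (t * w 0 i + (1 - t) * w' 0 i) =
    t * (c i x - w 0 i) + (1 - t) * (c i x - w' 0 i) by ring.
by rewrite lerD// ler_wpM2l ?envelope_le ?subr_ge0.
Qed.

Lemma envelope_lipschitz w h x : `|envelope (h + w) x - envelope w x| <= `|h|.
Proof.
have hi i : - `|h| <= h 0 i <= `|h| by rewrite -ler_norml coord_le_norm.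
rewrite ler_norml; apply/andP; split.
  rewrite lerBrDr; apply: le_envelope => i; rewrite mxE.
  have := hi i; have := envelope_le w x i; lra.
have [i iE] := envelope_attained w x.
have := envelope_le (h + w) x i; rewrite mxE.
have := hi i; lra.
Qed.

(** For [e = 0] these are the exact ties. Packing the two indices as a pair makes the set a union
    over a finite type. *)
Definition near_tie w (e : R) : set T :=
  [set x | exists p : 'I_n * 'I_n, [/\ p.1 != p.2,
    c p.1 x - w 0 p.1 <= envelope w x + e &
    c p.2 x - w 0 p.2 <= envelope w x + e]].

(** Where [i] is the only cell containing [x], the increment of the envelope has linear part
    [- h 0 i], hence the plus sign. *)
Definition remainder w h x : R :=
  envelope (h + w) x - envelope w x + \sum_i h 0 i * \1_(cell w i) x.

(** The norm is the maximum norm, so each weight moves by at most [|h|]. Near a tie, the increment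
    and each of the [n] indicator terms contribute at most [|h|]. Elsewhere the minimizing index
    leads by more than [2 * |h|], hence stays minimizing, and the remainder vanishes. *)
Lemma remainder_bound w h x :
  `|remainder w h x| <= (1 + n%:R) * `|h| * \1_(near_tie w (2 * `|h|)) x.
Proof.
have h0 : 0 <= `|h| by exact: normr_ge0.
have hi i : - `|h| <= h 0 i <= `|h| by rewrite -ler_norml coord_le_norm.
have [tie|ntie] := pselect (near_tie w (2 * `|h|) x).
  rewrite indicE mem_set// mulr1 mulrDl mul1r.
  apply: le_trans (ler_normD _ _) _; apply: lerD.
    exact: envelope_lipschitz.
  apply: le_trans (ler_norm_sum _ _ _) _.
  rewrite -[n in n%:R]card_ord mulr_natl -sumr_const; apply: ler_sum => i _.
  rewrite normrM -[leRHS]mulr1 ler_pM ?coord_le_norm// indicE.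
  by case: (_ \in _); rewrite ?normr0 ?normr1.
rewrite indicE memNset// mulr0.
have [i iE] := envelope_attained w x.
have gap j : j != i -> envelope w x + 2 * `|h| < c j x - w 0 j.
  move=> ji; rewrite ltNge; apply/negP => jle; apply: ntie; exists (j, i).
  by split=> //=; rewrite -iE lerDl mulr_ge0.
have hE : envelope (h + w) x = envelope w x - h 0 i.
  apply/eqP; rewrite eq_le; apply/andP; split.
    by have := envelope_le (h + w) x i; rewrite mxE; lra.
  apply: le_envelope => j; rewrite mxE.
  have [->|ji] := eqVneq j i; first lra.
  have := gap _ ji; have := hi i; have := hi j; lra.
rewrite /remainder hE (bigD1 i)//= big1 => [|j ji].
  by rewrite indicE mem_set ?mulr1; [|exact/cellP]; rewrite normr_le0; lra.
rewrite indicE memNset ?mulr0// => /cellP jE.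
by have := gap _ ji; rewrite jE; lra.
Qed.

(** * Measurability and integrability *)

Hypothesis mc : forall i, measurable_fun setT (c i).

Lemma measurable_shifted_cost w i : measurable_fun setT (fun x => c i x - w 0 i).
Proof. by apply: measurable_funB. Qed.

Lemma measurable_envelope w : measurable_fun setT (envelope w).
Proof.
rewrite /envelope; elim: (index_enum _) => [|i s IH].
  under eq_fun do rewrite big_nil.
  exact: measurable_shifted_cost.
under eq_fun do rewrite big_cons.
by apply: measurable_minr => //; exact: measurable_shifted_cost.
Qed.

Lemma measurable_cell w i : measurable (cell w i).
Proof.
rewrite (_ : cell w i =
    setT `&` (fun x => (c i x - w 0 i) - envelope w x) @^-1` [set 0]).
  apply: measurable_funB => //; [exact: measurable_shifted_cost|
                                 exact: measurable_envelope].
rewrite setTI; apply/seteqP; split => x; rewrite cellP /=.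
  by move=> ->; rewrite subrr.
by move/eqP; rewrite subr_eq0 => /eqP.
Qed.

Lemma measurable_near_tie w e : measurable (near_tie w e).
Proof.
pose A (i : 'I_n) := [set x | c i x - w 0 i <= envelope w x + e].
have mA i : measurable (A i).
  rewrite -[A i]setTI; apply: measurable_fun_le => //.
    exact: measurable_shifted_cost.
  by apply: measurable_funD => //; exact: measurable_envelope.
rewrite (_ : near_tie w e =
    \bigcup_(p in [set p : 'I_n * 'I_n | p.1 != p.2]) (A p.1 `&` A p.2)).
  by apply: fin_bigcup_measurable => // p _; exact: measurableI.
by apply/seteqP; split=> x [p]; [case=> pp p1 p2; exists p|move=> pp [p1 p2]; exists p].
Qed.

Hypothesis ic : forall i, mu.-integrable setT (EFin \o c i).

Lemma integrable_cst (k : R) : mu.-integrable setT (EFin \o cst k).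
Proof. exact: finite_measure_integrable_cst. Qed.

Lemma integrable_shifted_cost w i :
  mu.-integrable setT (EFin \o (fun x => c i x - w 0 i)).
Proof.
have := integrableB measurableT (ic i) (integrable_cst (w 0 i)).
exact: eq_integrable.
Qed.

Lemma integrable_envelope w : mu.-integrable setT (EFin \o envelope w).
Proof.
(* The minimum is one of the terms, so the sum of their absolute values dominates it. *)
pose b x := \sum_i `|c i x - w 0 i|.
apply: (@le_integrable _ _ _ _ _ _ _ (EFin \o b)) => //.
- exact/measurable_EFinP/measurable_envelope.
- move=> x _; rewrite /= lee_fin.
  have [i ->] := envelope_attained w x.
  rewrite [leRHS]ger0_norm ?sumr_ge0// /b (bigD1 i)//=.
  by rewrite lerDl sumr_ge0.
- apply: integrable_sumr => i; apply: integrable_norm.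
  exact: integrable_shifted_cost.
Qed.

Lemma integrable_indicr (A : set T) (k : R) : measurable A ->
  mu.-integrable setT (EFin \o (fun x => k * \1_A x)).
Proof.
move=> mA; have := integrableZl measurableT k (integrable_indic mu mA).
exact: eq_integrable.
Qed.

Lemma Rintegral_indic (A : set T) (k : R) : measurable A ->
  \int[mu]_x (k * \1_A x) = k * fine (mu A).
Proof.
move=> mA; rewrite RintegralZl//; last exact: integrable_indic.
by rewrite /Rintegral integral_indic// setIT.
Qed.

(** * Ties are null and near ties have small measure *)

Hypothesis null_ties : forall w i j, i != j -> mu (cell w i `&` cell w j) = 0%E.

Lemma ae_unique_cell w :
  {ae mu, forall x, forall i j, cell w i x -> cell w j x -> i = j}.
Proof.
(* Almost-everywhere statements commute with quantification over the finite type of pairs. *)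
have : {ae mu, forall x, forall p : 'I_n * 'I_n,
    cell w p.1 x -> cell w p.2 x -> p.1 = p.2}.
  apply: filter_forall => -[i j] /=.
  have [->|ij] := eqVneq i j; first exact: filterE.
  exists (cell w i `&` cell w j); split => //.
  - by apply: measurableI; exact: measurable_cell.
  - exact: null_ties.
  - by move=> x /= /not_implyP[Vi /not_implyP[Vj _]].
by apply: filterS => x H i j; exact: (H (i, j)).
Qed.

(** With tolerance 0 both indices attain the minimum, so the point lies in two distinct cells. *)
Lemma near_tie0_null w : mu (near_tie w 0) = 0%E.
Proof.
apply/eqP; rewrite -measure_le0.
have [N [mN N0 sN]] := ae_unique_cell w.
rewrite -N0; apply: le_measure; rewrite ?inE//; first exact: measurable_near_tie.
move=> x [[i j] /= [ij iE jE]]; apply: sN => /= /(_ i j) ijE.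
move/eqP: ij; apply; apply: ijE; apply/cellP/eqP.
  by rewrite eq_le envelope_le andbT -[leRHS]addr0.
by rewrite eq_le envelope_le andbT -[leRHS]addr0.
Qed.

(** Continuity from above of the finite measure [mu], along tolerances [1/(k+1)]: the sets decrease
    to the null set of exact ties. *)
Lemma near_tie_small w (e : R) : 0 < e ->
  exists2 r : R, 0 < r & forall r', r' <= r -> fine (mu (near_tie w r')) < e.
Proof.
move=> e0; pose F (k : nat) := near_tie w (k.+1%:R^-1).
have sub (r r' : R) : r <= r' -> near_tie w r `<=` near_tie w r'.
  move=> rr x [p [pp p1 p2]]; exists p; split=> //.
    by apply: le_trans p1 _; rewrite lerD2l.
  by apply: le_trans p2 _; rewrite lerD2l.
have capE : \bigcap_k F k = near_tie w 0.
  apply/seteqP; split=> [x Fx|x tx k _]; last first.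
    by move: tx; apply: sub; rewrite invr_ge0.
  apply: contrapT => ntie.
  have [i iE] := envelope_attained w x.
  have gap j : j != i -> envelope w x < c j x - w 0 j.
    move=> ji; rewrite ltNge; apply/negP => jle; apply: ntie; exists (j, i).
    by split=> //=; rewrite addr0// -iE.
  (* The smallest lead of [i] over the other indices; the default 1 keeps it positive when there are
     none. *)
  pose m := \big[Order.min/1]_(j | j != i) (c j x - w 0 j - envelope w x).
  have m0 : 0 < m.
    apply/bigmin_gtP; split=> // j ji.
    by rewrite subr_gt0 gap.
  have [k _ /(_ k (leqnn k)) /= km] := near_infty_natSinv_lt (PosNum m0).
  have far j : j != i -> envelope w x + k.+1%:R^-1 < c j x - w 0 j.
    move=> ji; rewrite -ltrBrDl; apply: lt_le_trans km _.
    exact: (bigmin_le_cond _ (fun j => c j x - w 0 j - envelope w x)).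
  (* Two distinct indices cannot both be [i], and any other index is beyond the tolerance. *)
  have [[j l] /= [jl jle lle]] := Fx k I.
  have [ji|/far] := eqVneq j i; last by rewrite ltNge jle.
  have /far : l != i by rewrite -ji eq_sym.
  by rewrite ltNge lle.
have Foo : fine \o (mu \o F) @ \oo --> (0 : R).
  suff : fine \o (mu \o F) @ \oo --> fine (mu (\bigcap_k F k)).
    by rewrite capE near_tie0_null.
  apply: fine_cvg; rewrite fineK; last first.
    by rewrite capE fin_num_measure//; exact: measurable_near_tie.
  apply: nonincreasing_cvg_mu.
  - exact: (le_lt_trans (probability_le1 _ (measurable_near_tie _ _))) (ltry _).
  - by move=> k; exact: measurable_near_tie.
  - by rewrite capE; exact: measurable_near_tie.
  - move=> k l kl; apply/subsetPset/sub.
    by rewrite lef_pV2 ?posrE// ler_nat ltnS.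
have [k _ /(_ k (leqnn k)) /= Fk] := cvgr_lt _ Foo _ e0.
exists k.+1%:R^-1 => [|r rk]; first by rewrite invr_gt0.
apply: le_lt_trans Fk; apply: fine_le.
- exact: fin_num_measure _ (measurable_near_tie _ _).
- exact: fin_num_measure _ (measurable_near_tie _ _).
- by apply: le_measure; rewrite ?inE; [exact: measurable_near_tie..|exact: sub].
Qed.

(** * Convexity and differentiability of the potential *)

Definition potential (lambda : 'I_n -> R) w : R :=
  \sum_i (- (lambda i * w 0 i) - \int[mu]_(x in cell w i) (c i x - w 0 i)).

(** On [cell w i] the integrand is the envelope, and almost every point lies in exactly one cell, so
    the restrictions to the cells add up to the envelope almost everywhere. *)
Lemma potentialE lambda w :
  potential lambda w = \sum_i - (lambda i * w 0 i) - \int[mu]_x envelope w x.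
Proof.
rewrite /potential big_split/= [X in _ + X]sumrN; congr (_ - _).
have cellE i : \int[mu]_(x in cell w i) (c i x - w 0 i) =
    \int[mu]_x ((envelope w) \_ (cell w i)) x.
  by rewrite -Rintegral_mkcond; apply: eq_Rintegral => x /set_mem /cellP.
under eq_bigr do rewrite cellE.
rewrite -Rintegral_sum => [|i]; last first.
  rewrite -restrict_EFin; apply: (iffLR (integrable_mkcond _ (measurable_cell w i))).
  by apply: integrableS (integrable_envelope w) => //; exact: measurable_cell.
apply: Rintegral_ae_eq_nonmeasurable.
apply: filterS (ae_unique_cell w) => x uniq_cell.
have [i /esym/cellP iE] := envelope_attained w x.
rewrite (bigD1 i)//= big1 ?addr0 => [|j ji]; first by rewrite patchE mem_set.
rewrite patchE memNset// => jE; move/eqP: ji; apply; exact: uniq_cell.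
Qed.

Lemma potential_convex lambda (t : R) w w' : 0 <= t <= 1 ->
  potential lambda (t *: w + (1 - t) *: w') <=
  t * potential lambda w + (1 - t) * potential lambda w'.
Proof.
move=> t01; rewrite !potentialE.
have iZ k u : mu.-integrable setT (EFin \o (fun x => k * envelope u x)).
  have := integrableZl measurableT k (integrable_envelope u).
  exact: eq_integrable.
have -> : \sum_i - (lambda i * (t *: w + (1 - t) *: w') 0 i) =
    t * (\sum_i - (lambda i * w 0 i)) + (1 - t) * (\sum_i - (lambda i * w' 0 i)).
  rewrite !mulr_sumr -big_split/=; apply: eq_bigr => i _.
  by rewrite !mxE; ring.
have : \int[mu]_x (t * envelope w x + (1 - t) * envelope w' x) <=
    \int[mu]_x envelope (t *: w + (1 - t) *: w') x.
  apply: le_Rintegral => //; last by move=> x _; exact: envelope_concave.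
    have := integrableD measurableT (iZ t w) (iZ (1 - t) w').
    exact: eq_integrable.
  exact: integrable_envelope.
rewrite RintegralD// !RintegralZl//; try exact: integrable_envelope.
lra.
Qed.

Lemma integrable_remainder w h : mu.-integrable setT (EFin \o remainder w h).
Proof.
have iB := integrableB measurableT (integrable_envelope (h + w))
  (integrable_envelope w).
have iS : mu.-integrable setT
    (EFin \o (fun x => \sum_i h 0 i * \1_(cell w i) x)).
  apply: integrable_sumr => i; apply: integrable_indicr; exact: measurable_cell.
have := integrableD measurableT iB iS; exact: eq_integrable.
Qed.

(** The [lambda] terms are linear and cancel; integrating the indicator of each cell turns the
    linearization of the envelope into the cell masses. The sign comes from the envelope entering
    the potential negatively. *)
Lemma potential_remainder lambda w h :
  potential lambda (h + w) - potential lambda w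
    - linear_form (fun i => - lambda i + fine (mu (cell w i))) h =
  - \int[mu]_x remainder w h x.
Proof.
have iI i : mu.-integrable setT (EFin \o (fun x => h 0 i * \1_(cell w i) x)).
  by apply: integrable_indicr; exact: measurable_cell.
rewrite /remainder RintegralD//; last 2 first.
- have := integrableB measurableT (integrable_envelope (h + w))
    (integrable_envelope w); exact: eq_integrable.
- exact: integrable_sumr.
rewrite RintegralB//; try exact: integrable_envelope.
rewrite Rintegral_sum// !potentialE /linear_form.
have -> : \sum_i \int[mu]_x (h 0 i * \1_(cell w i) x) =
    \sum_i h 0 i * fine (mu (cell w i)).
  by apply: eq_bigr => i _; rewrite Rintegral_indic//; exact: measurable_cell.
have -> : \sum_i - (lambda i * (h + w) 0 i) =
    \sum_i - (lambda i * w 0 i) + \sum_i - (lambda i * h 0 i).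
  by rewrite -big_split/=; apply: eq_bigr => i _; rewrite mxE; ring.
have -> : \sum_i (- lambda i + fine (mu (cell w i))) * h 0 i =
    \sum_i - (lambda i * h 0 i) + \sum_i h 0 i * fine (mu (cell w i)).
  by rewrite -big_split/=; apply: eq_bigr => i _; ring.
ring.
Qed.

Lemma potential_differentiable lambda w :
  differentiable (potential lambda) w /\
  'd (potential lambda) w =
    linear_form (fun i => - lambda i + fine (mu (cell w i)))
    :> ('rV[R]_n -> R).
Proof.
apply: differentiable_linear_form => e e0.
have n1 : 0 < 1 + n%:R :> R by rewrite ltr_pwDl.
(* Dividing by [1 + n] compensates the constant of [remainder_bound]. *)
have [r r0 small] := near_tie_small w (divr_gt0 e0 n1).
near=> h.
rewrite potential_remainder normrN.
apply: le_trans (le_normr_Rintegral _ (integrable_remainder w h)) _ => //.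
apply: (@le_trans _ _ ((1 + n%:R) * `|h| * fine (mu (near_tie w (2 * `|h|))))).
  rewrite -Rintegral_indic; last exact: measurable_near_tie.
  apply: le_Rintegral => //.
  - by apply: integrable_norm; exact: integrable_remainder.
  - by apply: integrable_indicr; exact: measurable_near_tie.
  - by move=> x _; exact: remainder_bound.
have -> : e * `|h| = (1 + n%:R) * `|h| * (e / (1 + n%:R)).
  by field; rewrite gt_eqF.
apply: ler_wpM2l; first by rewrite mulr_ge0// ltW.
suff /small /ltW : 2 * `|h| <= r by [].
rewrite -ler_pdivlMl//.
near: h; apply: (@nbhs0_le _ 'rV[R]_n); rewrite mulr_gt0// invr_gt0.
Unshelve. all: by end_near. Qed.

End lower_envelope.

(** * The Euclidean cost and the theorem *)

Section euclidean_cost.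
Context {R : realType} {d : nat}.

Lemma measurable_eucl_dist (p : Rd R d) :
  measurable_fun setT (fun x => eucl_dist x p).
Proof.
apply: (measurableT_comp (f := @Num.sqrt R)); last exact: measurable_sq_dist.
by apply: continuous_measurable_fun; exact: sqrt_continuous.
Qed.

(** The factor 2 is not sharp: it lets the coordinatewise bound [(a - b)^2 <= 2 a^2 + 2 b^2] replace
    the Cauchy-Schwarz inequality, and integrability follows all the same. *)
Lemma eucl_dist_le (x p : Rd R d) :
  eucl_dist x p <= 2 * eucl_norm x + 2 * eucl_norm p.
Proof.
have sqr_norm (y : Rd R d) : eucl_norm y ^+ 2 = \sum_k tnth y k ^+ 2.
  by rewrite sqr_sqrtr// sumr_ge0// => k _; exact: sqr_ge0.
have norm_ge0 (y : Rd R d) : 0 <= eucl_norm y by exact: sqrtr_ge0.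
have rhs0 : 0 <= 2 * eucl_norm x + 2 * eucl_norm p.
  by rewrite addr_ge0// mulr_ge0.
rewrite -(@ler_pXn2r _ 2)// ?nnegrE//; last exact: sqrtr_ge0.
rewrite sqr_eucl_dist.
apply: (@le_trans _ _ (2 * eucl_norm x ^+ 2 + 2 * eucl_norm p ^+ 2)).
  rewrite !sqr_norm !mulr_sumr -big_split/=; apply: ler_sum => k _.
  by rewrite -subr_ge0; have := sqr_ge0 (tnth x k + tnth p k); nra.
have := norm_ge0 x; have := norm_ge0 p; nra.
Qed.

Lemma integrable_eucl_dist (mu : probability (Rd R d) R) (p : Rd R d) :
  (\int[mu]_x (eucl_norm x)%:E < +oo)%E ->
  mu.-integrable setT (EFin \o (fun x => eucl_dist x p)).
Proof.
move=> moment.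
have mnorm : measurable_fun setT (@eucl_norm R d).
  have -> : @eucl_norm R d = fun x => eucl_dist x [tuple 0 | i < d].
    apply/funext => x; congr Num.sqrt; apply: eq_bigr => k _.
    by rewrite tnth_mktuple subr0.
  exact: measurable_eucl_dist.
have inorm : mu.-integrable setT (EFin \o @eucl_norm R d).
  apply/integrableP; split; first exact/measurable_EFinP.
  apply: le_lt_trans moment; rewrite le_eqVlt; apply/orP; left; apply/eqP.
  by apply: eq_integral => x _ /=; rewrite ger0_norm// sqrtr_ge0.
have ibound := integrableD measurableT (integrableZl measurableT 2 inorm)
  (@integrable_cst _ _ _ mu (2 * eucl_norm p)).
apply: le_integrable ibound => //.
  by apply/measurable_EFinP; exact: measurable_eucl_dist.
move=> x _; rewrite /= lee_fin ger0_norm ?sqrtr_ge0//.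
by rewrite ger0_norm ?eucl_dist_le// addr_ge0// mulr_ge0// sqrtr_ge0.
Qed.

End euclidean_cost.

(** On the real line [|x - a| - |x - b|] is constant on two half-lines, so for some weights cells
    can overlap in positive measure. For [d = 1], [boundary1] therefore records the assertion that
    cell boundaries are null; for larger [d] this is derived from the density. *)
Theorem theorem3p4 (R : realType) (d n : nat) (d_gt0 : (0 < d)%N)
    (n_gt0 : (0 < n)%N)
    (mu : probability (Rd R d) R) (rho : Rd R d -> R)
    (mrho : measurable_fun [set: Rd R d] rho)
    (rho_ge0 : forall x, 0 <= rho x)
    (mu_density : forall A : set (Rd R d), measurable A ->
      mu A = (\int[lebesgue_Rd d]_(x in A) (rho x)%:E)%E)
    (mu_moment : (\int[mu]_x (eucl_norm x)%:E < +oo)%E)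
    (s : 'I_n -> Rd R d) (s_inj : injective s)
    (lambda : 'I_n -> R) (lambda_gt0 : forall i, 0 < lambda i)
    (nu : probability (Rd R d) R)
    (nuE : forall A : set (Rd R d), measurable A ->
      nu A = (\sum_(i < n) (lambda i)%:E * \d_(s i) A)%E)
    (boundary1 : d = 1%N -> forall (w : 'rV[R]_n) (i j : 'I_n), i != j ->
      mu (Vor s w i `&` Vor s w j) = 0%E) :
  [/\ convex_function [set: 'rV[R]_n] (Phi mu lambda s),
      forall w : 'rV[R]_n,
        differentiable (Phi mu lambda s) w /\
        (forall i : 'I_n, 'D_(delta_mx 0 i) (Phi mu lambda s) w =
                          - lambda i + fine (mu (Vor s w i)))
    & forall (w : 'rV[R]_n) (T : Rd R d -> Rd R d), is_site_map mu s w T ->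
        Phi mu lambda s w =
          \sum_(i < n) - (lambda i * w 0 i)
          - \int[mu]_x (eucl_dist x (T x) - site_weight s w (T x)) ].
Proof.
pose c (i : 'I_n) (x : Rd R d) := eucl_dist x (s i).
pose i0 := Ordinal n_gt0.
have mc i : measurable_fun setT (c i) by exact: measurable_eucl_dist.
have ic i : mu.-integrable setT (EFin \o c i) by exact: integrable_eucl_dist.
have PhiE : Phi mu lambda s = potential mu c lambda by [].
have null_ties w i j : i != j -> mu (cell c w i `&` cell c w j) = 0%E.
  move=> ij; have [d1|d1] := eqVneq d 1%N; first exact: boundary1.
  have sij : s i != s j by rewrite (inj_eq s_inj).
  have d2 : (1 < d)%N by case: (d) d_gt0 d1 => [|[|]].
  have [N [mN N0 sN]] :=
    lebesgue_Rd_equal_dist_difference (w 0 i - w 0 j) d2 sij.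
  have muN : mu N = 0%E.
    rewrite mu_density// null_set_integral//.
    exact/measurable_EFinP/measurable_funTS.
  apply/eqP; rewrite -measure_le0 -muN; apply: le_measure; rewrite ?inE//.
    by apply: measurableI; exact: measurable_cell.
  (* On both cells the two shifted distances equal the envelope, so the distances differ by
     [w 0 i - w 0 j]. *)
  move=> x [/(cellP i0) iE /(cellP i0) jE]; apply: sN => /=.
  by move: iE; rewrite -jE /c; lra.
rewrite PhiE; split.
- move=> t w w' _ _; apply: potential_convex => //.
  by apply/andP; split.
- move=> w; have [dPhi dPhiE] := potential_differentiable i0 mc ic null_ties lambda w.
  split=> // i; rewrite deriveE// dPhiE /linear_form (bigD1 i)//= big1.
    by rewrite mxE !eqxx mulr1 addr0.
  by move=> j ji; rewrite mxE eqxx/= (negbTE ji) mulr0.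
- move=> w T siteT; rewrite (potentialE i0)//; congr (_ - _).
  (* [T] is arbitrary on a null set, so its integrand may fail to be measurable. Where [T x = s i]
     with [x] in cell [i], injectivity of [s] reduces [site_weight] to [w 0 i], and the integrand is
     the envelope. *)
  apply: Rintegral_ae_eq_nonmeasurable.
  apply: filterS siteT => x [i Vix ->].
  have /(cellP i0) <- : cell c w i x by [].
  rewrite /site_weight (bigD1 i)//= big1 ?addr0// => j /andP[/eqP/s_inj ->].
  by rewrite eqxx.
Qed.
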